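(* For every ladder system $\mathbf C$ on $\omega_1$ and every $\omega$-colouring $\mathbf f=(f_\alpha)_{\alpha\in\lim(\omega_1)}$ of $\mathbf C$ there is a ccc forcing $\mathcal P_{\mathbf f}$ of size $\aleph_1$ such that (1) $\mathcal P_{\mathbf f}$ forces that there is an $\omega_1$-uniformization of $\mathbf f$, and (2) for every Suslin tree $R$ in the ground model, $\mathcal P_{\mathbf f}$ forces that $R$ is still a Suslin tree.
   Context: A ladder system is $\mathbf C=(C_\alpha)_{\alpha\in\lim(\omega_1)}$ with $C_\alpha$ a cofinal subset of the countable limit ordinal $\alpha$ of order type $\omega$. An $\omega$-colouring of $\mathbf C$ is a sequence $(f_\alpha)$ with $f_\alpha:C_\alpha\to\omega$. An $\omega_1$-uniformization of $\mathbf f$ is a function $\varphi:\omega_1\to\omega$ such that for every limit $\alpha<\omega_1$, $\varphi(\xi)=f_\alpha(\xi)$ for all but finitely many $\xi\in C_\alpha$. A Suslin tree is a tree of height $\omega_1$ (predecessors of each node well ordered) with countable levels and no uncountable chains or antichains. *)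

(* Defs.v *)
From mathcomp Require Import all_boot.
From mathcomp Require Import boolp classical_sets functions cardinality.

Set Implicit Arguments.
Unset Strict Implicit.
Unset Printing Implicit Defensive.

Local Open Scope classical_set_scope.

(* Ground model and extension. The ground model is the universe of types.
   Statements about the generic extension are written in the second-order
   language below, whose individuals are the elements of ground-model types
   and whose second-order objects are the subsets of ground-model types
   (functions and relations are subsets of products). The parameter [N] tells
   what stands for a subset of [X]: [N := set] gives a statement about the
   ground model, and [N := name P] (P-names of subsets of [X]) a statement of
   the forcing language of P. [Atom A] is used only for ground-model relations
   between ground-model elements. *)
Inductive formula (N : Type -> Type) : Type :=
| Atom of Prop
| Mem (X : Type) (x : X) (U : N X)
| Not of formula N
| And of formula N & formula N
| Or of formula N & formula N
| Imp of formula N & formula N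
| All (X : Type) of (X -> formula N)
| Ex (X : Type) of (X -> formula N)
| AllS (X : Type) of (N X -> formula N)
| ExS (X : Type) of (N X -> formula N).

Arguments Atom {N} _.
Arguments Mem {N X} x U.

Declare Scope formula_scope.
Delimit Scope formula_scope with F.
Bind Scope formula_scope with formula.

Notation "x ∈ U" := (Mem x U) (at level 30) : formula_scope.
Notation "~~ A" := (Not A) : formula_scope.
Notation "A && B" := (And A B) : formula_scope.
Notation "A || B" := (Or A B) : formula_scope.
Notation "A ==> B" := (Imp A B) : formula_scope.
Notation "∀ x : X , A" := (All (fun x : X => A%F))
  (at level 200, x name, X at level 99, A at level 200) : formula_scope.
Notation "∃ x : X , A" := (Ex (fun x : X => A%F))
  (at level 200, x name, X at level 99, A at level 200) : formula_scope.
(* second-order quantifiers, over the subsets of [X] *)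
Notation "∀² U ⊂ X , A" := (AllS (X := X) (fun U => A%F))
  (at level 200, U name, X at level 99, A at level 200) : formula_scope.
Notation "∃² U ⊂ X , A" := (ExS (X := X) (fun U => A%F))
  (at level 200, U name, X at level 99, A at level 200) : formula_scope.

(* truth in the ground model *)
Fixpoint holds (F : formula set) : Prop :=
  match F with
  | Atom A => A
  | Mem X x U => U x
  | Not F => ~ holds F
  | And F G => holds F /\ holds G
  | Or F G => holds F \/ holds G
  | Imp F G => holds F -> holds G
  | All X F => forall x, holds (F x)
  | Ex X F => exists x, holds (F x)
  | AllS X F => forall U, holds (F U)
  | ExS X F => exists U, holds (F U)
  end.

(* [fle p q]: p is stronger than q *)
Record forcing := Forcing {
  fcarrier :> Type;
  fle : fcarrier -> fcarrier -> Prop;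
  ftop : fcarrier;
  fle_refl : forall p, fle p p;
  fle_trans : forall q p r, fle p q -> fle q r -> fle p r;
  fle_top : forall p, fle p ftop
}.
Arguments fle {f} _ _.

Section Forcing.
Variable P : forcing.

Definition compatible (p q : P) := exists2 r : P, fle r p & fle r q.

Definition ccc := forall A : set P,
  (forall p q, A p -> A q -> p <> q -> ~ compatible p q) -> countable A.

Definition dense_below (p : P) (D : P -> Prop) :=
  forall q, fle q p -> exists2 r, fle r q & D r.

(* A P-name for a subset of X is a set of pairs (x, p), meaning (x-check, p). *)
Definition name (X : Type) : Type := set (X * P).

Fixpoint forces (p : P) (F : formula name) : Prop :=
  match F with
  | Atom A => A
  | Mem X x U => dense_below p (fun q => exists2 s, U (x, s) & fle q s)
  | Not F => forall q, fle q p -> ~ forces q F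
  | And F G => forces p F /\ forces p G
  | Or F G => dense_below p (fun q => forces q F \/ forces q G)
  | Imp F G => forall q, fle q p -> forces q F -> forces q G
  | All X F => forall x, forces p (F x)
  | Ex X F => dense_below p (fun q => exists x, forces q (F x))
  | AllS X F => forall U, forces p (F U)
  | ExS X F => dense_below p (fun q => exists U, forces q (F U))
  end.

Definition forced (F : formula name) := forall p, forces p F.

Lemma forces_mono (F : formula name) (p q : P) :
  fle q p -> forces p F -> forces q F.
Proof.
have mono D (p' q' : P) : fle q' p' -> dense_below p' D -> dense_below q' D.
  by move=> qp Dp r rq; apply: Dp; apply: fle_trans qp.
elim: F p q => [A|X x U|F _|F IF G IG|F _ G _|F _ G _|X F IF|X F _|X F IF|X F _]
  p q qp //=; try exact: mono.
- by move=> H r rq; apply: H; apply: fle_trans qp.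
- by case=> HF HG; split; [apply: IF HF|apply: IG HG].
- by move=> H r rq; apply: H; apply: fle_trans qp.
- by move=> H x; apply: IF (H x).
- by move=> H U; apply: IF (H U).
Qed.

Lemma forces_dense (F : formula name) (p : P) :
  dense_below p (fun q => forces q F) -> forces p F.
Proof.
have dd D (p' : P) : dense_below p' (fun q => dense_below q D) ->
    dense_below p' D.
  move=> H q /H[r rq /(_ r (fle_refl r))[s sr Ds]].
  by exists s => //; apply: fle_trans rq.
elim: F p => [A|X x U|F _|F IF G IG|F _ G _|F _ G IG|X F IF|X F _|X F IF|X F _]
  p //=; try exact: dd.
- by move=> /(_ p (fle_refl p))[].
- move=> H q /H[r rq nF] Fq.
  by apply: (nF r (fle_refl r)); apply: forces_mono Fq.
- by move=> H; split; [apply: IF|apply: IG] => q /H[r rq []]; exists r.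
- move=> H q qp Fq; apply: IG => r rq.
  have [s sr Hs] := H r (fle_trans rq qp).
  by exists s => //; apply: Hs (fle_refl s) _; apply: forces_mono Fq; apply: fle_trans rq.
- by move=> H x; apply: IF => q /H[r rq]; exists r.
- by move=> H U; apply: IF => q /H[r rq]; exists r.
Qed.

End Forcing.

Section Formulas.
Variable N : Type -> Type.
Local Open Scope formula_scope.

Definition univ {X : Type} : X -> formula N := fun _ => Atom True.

(* [G] maps A to B as a function; A and B are definable classes *)
Definition maps {X Y : Type} (A : X -> formula N) (B : Y -> formula N)
    (G : N (X * Y)%type) : formula N :=
  ∀ x : X, A x ==>
    (∃ y : Y, B y && (x, y) ∈ G)
    && (∀ y : Y, ∀ z : Y, (x, y) ∈ G ==> (x, z) ∈ G ==> Atom (y = z)).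

Definition one_to_one {X Y : Type} (A : X -> formula N) (G : N (X * Y)%type) :
    formula N :=
  ∀ x : X, ∀ x' : X, ∀ y : Y,
    A x ==> A x' ==> (x, y) ∈ G ==> (x', y) ∈ G ==> Atom (x = x').

Definition onto {X Y : Type} (A : X -> formula N) (B : Y -> formula N)
    (G : N (X * Y)%type) : formula N :=
  ∀ y : Y, B y ==> ∃ x : X, A x && (x, y) ∈ G.

Definition embeds {X Y : Type} (A : X -> formula N) (B : Y -> formula N) :
    formula N :=
  ∃² G ⊂ (X * Y)%type, maps A B G && one_to_one A G.

Definition is_countable {X : Type} (A : X -> formula N) : formula N :=
  embeds A (univ (X := nat)).

Definition is_finite {X : Type} (A : X -> formula N) : formula N :=
  ∃ n : nat, embeds A (fun m : nat => Atom (m < n)).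

Definition well_ordered {X : Type} (lt : X -> X -> Prop) (A : X -> formula N) :
    formula N :=
  (∀ x : X, A x ==> ~~ Atom (lt x x))
  && (∀ x : X, ∀ y : X, ∀ z : X, A x ==> A y ==> A z ==>
        Atom (lt x y) ==> Atom (lt y z) ==> Atom (lt x z))
  && (∀ x : X, ∀ y : X, A x ==> A y ==>
        Atom (lt x y) || Atom (x = y) || Atom (lt y x))
  && (∀² S ⊂ X, (∃ x : X, A x && x ∈ S) ==>
        ∃ x : X, A x && x ∈ S &&
          (∀ y : X, A y ==> y ∈ S ==> ~~ Atom (lt y x))).

(* (W, lt) has order type omega_1 *)
Definition is_omega1 {W : Type} (lt : W -> W -> Prop) : formula N :=
  well_ordered lt univ
  && ~~ is_countable (univ (X := W))
  && (∀ a : W, is_countable (fun x : W => Atom (lt x a))).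

Definition is_tree {T : Type} (lt : T -> T -> Prop) : formula N :=
  (∀ x : T, ~~ Atom (lt x x))
  && (∀ x : T, ∀ y : T, ∀ z : T,
        Atom (lt x y) ==> Atom (lt y z) ==> Atom (lt x z))
  && (∀ t : T, well_ordered lt (fun s : T => Atom (lt s t))).

(* t is on level a: the predecessors of t are order isomorphic to the set of
   elements of W below a *)
Definition on_level {W T : Type} (ltW : W -> W -> Prop) (ltT : T -> T -> Prop)
    (a : W) (t : T) : formula N :=
  let pred (s : T) := Atom (ltT s t) in
  let seg (x : W) := Atom (ltW x a) in
  ∃² G ⊂ (T * W)%type,
    maps pred seg G && one_to_one pred G && onto pred seg G
    && (∀ s : T, ∀ s' : T, ∀ x : W, ∀ x' : W,
          pred s ==> pred s' ==> (s, x) ∈ G ==> (s', x') ∈ G ==>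
          Atom (ltT s s' <-> ltW x x')).

Definition is_chain {T : Type} (lt : T -> T -> Prop) (S : N T) : formula N :=
  ∀ x : T, ∀ y : T, x ∈ S ==> y ∈ S ==>
    Atom (lt x y) || Atom (x = y) || Atom (lt y x).

Definition is_antichain {T : Type} (lt : T -> T -> Prop) (S : N T) :
    formula N :=
  ∀ x : T, ∀ y : T, x ∈ S ==> y ∈ S ==>
    ~~ Atom (lt x y) && ~~ Atom (lt y x).

(* The ordinal omega_1 measuring the height is given as a ground-model
   well-order W; the first conjunct requires that it is the omega_1 of the
   model in which the formula is interpreted. *)
Definition suslin_tree {W T : Type} (ltW : W -> W -> Prop)
    (ltT : T -> T -> Prop) : formula N :=
  is_omega1 ltW
  && is_tree ltT
  && ((∀ t : T, ∃ a : W, on_level ltW ltT a t)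
      && (∀ a : W, ∃ t : T, on_level ltW ltT a t))
  && (∀ a : W, is_countable (on_level ltW ltT a))
  && (∀² S ⊂ T, is_chain ltT S ==> is_countable (fun t : T => t ∈ S))
  && (∀² S ⊂ T, is_antichain ltT S ==> is_countable (fun t : T => t ∈ S)).

Definition is_limit {W : Type} (lt : W -> W -> Prop) (a : W) : Prop :=
  (exists x, lt x a) /\ (forall x, lt x a -> exists2 y, lt x y & lt y a).

(* There is phi : W -> nat such that for every limit a, phi x = f a x for all
   but finitely many x in C a. *)
Definition has_uniformization {W : Type} (lt : W -> W -> Prop)
    (C : W -> set W) (f : W -> W -> nat) : formula N :=
  ∃² phi ⊂ (W * nat)%type,
    maps univ univ phi
    && (∀ a : W, Atom (is_limit lt a) ==>
          is_finite (fun x : W => Atom (C a x) && ~~ ((x, f a x) ∈ phi))).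

End Formulas.

Arguments is_omega1 {N W} lt.
Arguments suslin_tree {N W T} ltW ltT.
Arguments has_uniformization {N W} lt C f.

Lemma holds_is_countable (X : Type) (A : X -> formula set) :
  holds (is_countable A) <-> countable [set x | holds (A x)].
Proof.
rewrite /is_countable /embeds /maps /one_to_one /=; split.
  case=> G [Gf Gi]; apply/countable_injP.
  have /choice[g gP] x : exists n, holds (A x) -> G (x, n).
    have [/Gf[[n [_ Gn]] _]|nA] := pselect (holds (A x)); first by exists n.
    by exists 0.
  exists g => x y; rewrite !inE /= => Ax Ay e.
  by apply: (Gi x y (g x)) => //; [exact: gP|rewrite e; exact: gP].
move=> /countable_injP[g gi].
exists [set xn | xn.2 = g xn.1]; split => /=.
  by move=> x _; split=> [|y z -> ->//]; exists (g x).
by move=> x x' y Ax Ax' -> e; apply: gi; rewrite ?inE.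
Qed.

(* Only the values of C at limits are constrained. The map e enumerates C a
   increasingly, i.e. it witnesses that C a has order type omega. *)
Definition ladder_system {W : Type} (lt : W -> W -> Prop) (C : W -> set W) :=
  forall a, is_limit lt a ->
    [/\ forall x, C a x -> lt x a,
        forall y, lt y a -> exists2 x, C a x & y = x \/ lt y x
      & exists2 e : nat -> W,
          forall m n, m < n -> lt (e m) (e n) & range e = C a].

(* Main.v *)
Require Import Defs.
From mathcomp Require Import all_boot.
From mathcomp Require Import boolp classical_sets functions cardinality.
Set Implicit Arguments.
Unset Strict Implicit.
Unset Printing Implicit Defensive.
Local Open Scope classical_set_scope.

(* A condition is a finite list of instructions "phi x = n" or "phi = f_a on
   C_a", and describes a partial function from omega_1 to omega; stronger
   conditions describe larger functions. The generic function uniformizes f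
   because distinct ladders have finite intersection.

   Since C_a meets every d < a in a finite set, the restriction of a condition
   to a limit d is again given by a condition with parameters below d, unless
   the condition mentions d itself. A reflection argument at infinitely many
   such d then shows that the product of this forcing with every ccc partial
   order is ccc. Applied to a Suslin tree R, this says that no condition can
   create an uncountable antichain of R. It cannot create an uncountable chain
   B either: the nodes that branch off B would give an uncountable antichain
   in the product. *)

(** * Antichains, countable sets and omega_1 *)

(** The compatibility relation is arbitrary, so that forcings, trees under comparability and their
    products are treated alike. *)
Definition antichain_for {T : Type} (c : T -> T -> Prop) (A : set T) :=
  forall x y, A x -> A y -> x <> y -> ~ c x y.

Definition ccc_rel {T : Type} (c : T -> T -> Prop) :=
  forall A : set T, antichain_for c A -> countable A.

(** By Zorn's lemma: an element of [Y] compatible with no member of a maximal [Z] could be added to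
    [Z]. *)
Lemma maximal_antichain (T : Type) (c : T -> T -> Prop) (Y : set T) :
  (forall x, c x x) -> (forall x y, c x y -> c y x) ->
  exists Z : set T, [/\ Z `<=` Y, antichain_for c Z
    & forall y, Y y -> exists2 z, Z z & c z y].
Proof.
move=> crefl csym.
have [F FP Ftot|Z [[ZY Za] Zmax]] :=
    @Zorn_bigcup T [set Z | Z `<=` Y /\ antichain_for c Z].
  split; first by move=> x [Z /FP[ZY _]] /ZY.
  move=> x y [Z FZ Zx] [Z' FZ' Z'y] nxy.
  have [/(_ _ Zx) Z'x|/(_ _ Z'y) Zy] := Ftot _ _ FZ FZ'.
    exact: (FP _ FZ').2.
  exact: (FP _ FZ).2.
exists Z; split=> // y Yy; apply: contrapT => ny.
have nZy : ~ Z y by move=> Zy; apply: ny; exists y.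
apply: (Zmax (Z `|` [set y])).
  rewrite properEneq; split; last by move=> x; left.
  by apply/eqP => e; apply: nZy; rewrite e; right.
split; first by move=> x [/ZY//|->].
move=> x z [Zx|->] [Zz|->] // nxz.
- exact: Za.
- by move=> cxy; apply: ny; exists x.
- by move=> cyz; apply: ny; exists z => //; apply: csym.
Qed.

Lemma subset_countable (T : Type) (A B : set T) :
  A `<=` B -> countable B -> countable A.
Proof. by move=> AB; apply: sub_countable; apply: subset_card_le. Qed.

Lemma image_countable (T U : Type) (g : T -> U) (A : set T) :
  countable A -> countable (g @` A).
Proof. by move=> cA; apply: sub_countable cA; apply: card_image_le. Qed.

Lemma inj_countable (T U : Type) (g : T -> U) (A : set T) (B : set U) :
  {in A &, injective g} -> (forall x, A x -> B (g x)) ->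
  countable B -> countable A.
Proof.
move=> gi gAB cB; rewrite -(eq_countable (inj_card_eq gi)).
by apply: subset_countable cB => _ [x Ax <-]; apply: gAB.
Qed.

Lemma setU_countable (T : Type) (A B : set T) :
  countable A -> countable B -> countable (A `|` B).
Proof.
move=> cA cB; have -> : A `|` B = \bigcup_(b in [set: bool]) (if b then A else B).
  apply/seteqP; split=> [y [Ay|By]|y [[] _ ?]]; [|by exists false|by left|by right].
  by exists true.
by apply: bigcup_countable => // -[].
Qed.

Lemma card_leT_inj (T U : Type) (g : T -> U) :
  injective g -> ([set: T] #<= [set: U])%card.
Proof.
move=> gi; rewrite -(card_le_eql (inj_card_eq (in2W gi))).
exact: card_leT.
Qed.

(** * The order type omega_1 *)

Record omega1_order {W : Type} (lt : W -> W -> Prop) : Prop := Omega1Order {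
  o1_irr : forall x, ~ lt x x;
  o1_trans : forall y x z, lt x y -> lt y z -> lt x z;
  o1_total : forall x y, [\/ lt x y, x = y | lt y x];
  o1_min : forall S : set W, S !=set0 ->
    exists2 x, S x & forall y, S y -> ~ lt y x;
  o1_uncountable : ~ countable [set: W];
  o1_seg : forall a, countable [set x | lt x a]
}.

Lemma holds_omega1 (W : Type) (lt : W -> W -> Prop) :
  holds (is_omega1 lt) -> omega1_order lt.
Proof.
move=> [[[[[irr tr] tot] mn] unc] seg]; split.
- by move=> x; apply: irr.
- by move=> y x z; apply: tr.
- by move=> x y; have [[]|] := tot x y I I; [constructor 1|constructor 2|constructor 3].
- move=> S [x0 Sx0]; have [|x [[_ Sx] h]] := mn S; first by exists x0.
  by exists x => // y Sy; apply: h.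
- move=> cW; apply: unc; apply: (holds_is_countable (@univ set W)).2.
  exact: subset_countable cW.
- by move=> a; apply: (holds_is_countable (fun x => Atom (lt x a))).1 (seg a).
Qed.

Section Omega1.
Variables (W : Type) (lt : W -> W -> Prop).
Hypothesis hW : omega1_order lt.

Lemma o1_ind (Q : W -> Prop) :
  (forall a, (forall b, lt b a -> Q b) -> Q a) -> forall a, Q a.
Proof.
move=> ih a; apply: contrapT => na.
have [|x nx xmin] := @o1_min _ _ hW [set x | ~ Q x]; first by exists a.
by apply: nx; apply: ih => b ba; apply: contrapT => /xmin.
Qed.

Lemma o1_wf : well_founded lt.
Proof. by move=> a; elim/o1_ind: a => a ih; constructor. Qed.

Lemma o1_bounded (K : set W) : countable K ->
  exists b, forall x, K x -> lt x b.
Proof.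
move=> cK; apply: contrapT => nb; apply: (o1_uncountable hW).
apply: (@subset_countable _ _ (\bigcup_(x in K) ([set y | lt y x] `|` [set x]))).
  move=> b _; apply: contrapT => nbK; apply: nb; exists b => x Kx.
  have [//|e|bx] := o1_total hW x b; exfalso; apply: nbK; exists x => //.
    by right.
  by left.
apply: bigcup_countable => // x _.
by apply: setU_countable; [apply: o1_seg|apply: countable1].
Qed.

Lemma o1_infinite_compl (U : set W) : countable U -> infinite_set (~` U).
Proof.
move=> cU fU; apply: (o1_uncountable hW).
rewrite -(setUv U); apply: setU_countable => //.
exact: finite_set_countable.
Qed.

Lemma o1_inhabited : inhabited W.
Proof.
apply: contrapT => nW; apply: (o1_uncountable hW).
by apply: (@subset_countable _ _ set0) => // x _; apply: nW.
Qed.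

Lemma o1_avoid (U : set W) : countable U ->
  exists2 g : nat -> W, injective g & forall n, ~ U (g n).
Proof.
move=> /o1_infinite_compl/infiniteP/card_leP[g].
exists (fun n => sval (g (exist _ n (mem_set (I : setT n))))) => [m n|n].
  move=> /val_inj e; have := @inj _ _ _ g _ _ (in_setT _) (in_setT _) e.
  by case.
by case: (g _) => x /= /set_mem.
Qed.

(* [omega1 * omega] embeds in [omega1]: recursively give every [a] a copy of
   omega that avoids the copies given to its predecessors. *)
Lemma o1_prod_nat_inj : exists G : W -> nat -> W,
  forall a b m n, G a m = G b n -> a = b /\ m = n.
Proof.
have [w0] := o1_inhabited.
pose good a (r : forall b, lt b a -> nat -> W) (g : nat -> W) :=
  injective g /\ forall b (ba : lt b a) m n, g m <> r b ba n.
pose step a r := if pselect (exists g, good a r g) is left h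
  then projT1 (cid h) else fun=> w0.
pose G := Fix o1_wf (fun=> nat -> W) step.
have GE a : G a = step a (fun b _ => G b).
  rewrite /G Fix_eq // => x r r' rr'; congr step.
  by apply: functional_extensionality_dep => b; apply: functional_extensionality_dep.
have GP a : injective (G a) /\ forall b, lt b a -> forall m n, G a m <> G b n.
  have cU : countable (\bigcup_(b in [set b | lt b a]) range (G b)).
    apply: bigcup_countable => [|b _]; first exact: o1_seg.
    exact: image_countable.
  have [g gi gU] := o1_avoid cU.
  rewrite GE /step; case: pselect => [h|[]].
    by case: cid => h' [hi hn]; split=> // b ba m n; apply: hn.
  exists g; split=> // b ba m n e; apply: (gU m); exists b => //.
  by exists n.
exists G => a b m n e; have [ab|ab|ba] := o1_total hW a b.
- by exfalso; apply: ((GP b).2 a ab n m).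
- by rewrite -ab in e *; split=> //; apply: (GP a).1.
- by exfalso; apply: ((GP a).2 b ba m n).
Qed.

(** Take [d] as the least strict upper bound of the iterates of [h] at [a0]; each [a] below [d] lies
    below some iterate, which serves as [b]. *)
Lemma o1_closure_limit (h : W -> W) (a0 : W) : (forall a, lt a (h a)) ->
  exists d, [/\ lt a0 d, is_limit lt d
    & forall a, lt a d -> exists b, [/\ lt a b, lt b d & lt (h b) d]].
Proof.
move=> hlt; pose x n := iter n h a0.
have [d0 d0P] := @o1_bounded (range x) (image_countable _ (countableP _)).
have [|d dP dmin] := @o1_min _ _ hW [set d | forall n, lt (x n) d].
  by exists d0 => n; apply: d0P; exists n.
have below a : lt a d -> exists n, lt a (x n).
  move=> ad; apply: contrapT => na; apply: (dmin a) => // n.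
  have [//|e|axn] := o1_total hW (x n) a; exfalso; apply: na.
    by exists n.+1; rewrite -e; apply: hlt.
  by exists n.
exists d; split.
- exact: (dP 0).
- split; first by exists a0; apply: (dP 0).
  by move=> a /below[n an]; exists (x n).
- by move=> a /below[n an]; exists (x n); split=> //; apply: (dP n.+1).
Qed.

End Omega1.

(** * Forcing statements about ground-model orders *)

Section Forces.
Variable P : forcing.
Implicit Types p q r : P.

Definition check_name {X : Type} (G : set X) : name P X := [set xp | G xp.1].

Lemma forces_check p (X : Type) (x : X) (G : set X) :
  forces p (x ∈ check_name G)%F <-> G x.
Proof.
split=> [/(_ p (fle_refl p))[r _ []]//|Gx q _].
by exists q; [apply: fle_refl|exists q => //; apply: fle_refl].
Qed.

Lemma forces_orl p (F G : formula (name P)) : forces p F -> forces p (F || G)%F.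
Proof.
move=> Fp q qp; exists q; first exact: fle_refl.
by left; apply: forces_mono Fp.
Qed.

Lemma forces_orr p (F G : formula (name P)) : forces p G -> forces p (F || G)%F.
Proof.
move=> Gp q qp; exists q; first exact: fle_refl.
by right; apply: forces_mono Gp.
Qed.

Lemma forces_or_atom p (A B : Prop) (F : formula (name P)) :
  (forall q, fle q p -> forces q F -> A) -> forces p (F || Atom B)%F -> A \/ B.
Proof.
move=> FA /(_ p (fle_refl p))[q qp [Fq|Bq]]; last by right.
by left; apply: FA Fq.
Qed.

Definition comparable_by {X : Type} (lt : X -> X -> Prop) (x y : X) :=
  (lt x y \/ x = y) \/ lt y x.

Lemma forces_comparable p (X : Type) (lt : X -> X -> Prop) (x y : X) :
  forces p (Atom (lt x y) || Atom (x = y) || Atom (lt y x))%F <->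
  comparable_by lt x y.
Proof.
split; last first.
  move=> [[h|h]|h]; last exact: forces_orr.
    by apply: forces_orl; apply: forces_orl.
  by apply: forces_orl; apply: forces_orr.
by apply: forces_or_atom => q _; apply: forces_or_atom.
Qed.

(** [A'] is a ground-model set covering whatever [A] can become below [p], so the check name of the
    graph of [g] witnesses the embedding. *)
Lemma forces_embeds p (X : Type) (A : X -> formula (name P)) (A' : set X)
    (B : nat -> Prop) (g : X -> nat) :
  (forall x q, fle q p -> forces q (A x) -> A' x) ->
  (forall x, A' x -> B (g x)) -> {in A' &, injective g} ->
  forces p (embeds A (fun n => Atom (B n))).
Proof.
move=> AA' A'B gi q qp; exists q; first exact: fle_refl.
exists (check_name [set xn | xn.2 = g xn.1]); split.
- move=> x r rq Ar; have A'x := AA' x r (fle_trans rq qp) Ar.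
  split; last first.
    by move=> y z r1 _ /forces_check/= -> r2 _ /forces_check/= ->.
  move=> s sr; exists s; first exact: fle_refl.
  by exists (g x); split; [apply: A'B|apply/forces_check].
- move=> x x' y r rq Ax s sr Ax' u us /forces_check/= -> v vu /forces_check/= e.
  apply: gi => //; rewrite inE.
    by apply: AA' Ax; apply: fle_trans qp.
  by apply: AA' Ax'; apply: fle_trans sr (fle_trans rq qp).
Qed.

Lemma forces_countable p (X : Type) (A : X -> formula (name P)) (A' : set X) :
  (forall x q, fle q p -> forces q (A x) -> A' x) -> countable A' ->
  forces p (is_countable A).
Proof.
by move=> AA' /countable_injP[g gi]; apply: (@forces_embeds _ _ _ A' _ g).
Qed.

Lemma forces_finite p (X : Type) (A : X -> formula (name P)) (A' : set X) :
  (forall x q, fle q p -> forces q (A x) -> A' x) -> finite_set A' ->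
  forces p (is_finite A).
Proof.
move=> AA' /finite_set_leP[n /pcard_leP[g]] q qp.
exists q; first exact: fle_refl.
exists n; apply: (@forces_embeds _ _ _ A' _ g).
- by move=> x r rq; apply: AA'; apply: fle_trans qp.
- by move=> x /(@funS _ _ _ _ g).
- exact: inj.
Qed.

(** A ground-model set that [p] forces to cover [S]; countability of [S] is reduced to it. *)
Definition possible {X : Type} p (S : name P X) : set X :=
  [set x | exists2 q, fle q p & forces q (x ∈ S)%F].

Lemma forces_countable_possible p (X : Type) (S : name P X) :
  countable (possible p S) -> forces p (is_countable (fun x => x ∈ S)%F).
Proof. by apply: forces_countable => x q qp Sx; exists q. Qed.

(** Only the minimum of a new subset [S] needs an argument: some [u] puts the least element of
    [possible r S] into [S], and nothing smaller can enter. *)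
Lemma forces_well_ordered p (X : Type) (lt : X -> X -> Prop) (A : X -> Prop) :
  holds (well_ordered lt (fun x => Atom (A x))) ->
  forces p (well_ordered lt (fun x => Atom (A x))).
Proof.
move=> [[[irr tr] tot] mn]; split; [split; [split|]|].
- by move=> x q _ Ax r _; apply: irr.
- move=> x y z ? _ Ax ? _ Ay ? _ Az ? _ xy ? _ yz.
  exact: tr xy yz.
- by move=> x y ? _ Ax ? _ Ay; apply/forces_comparable/tot.
move=> S q qp ex r rq.
have [s sr [x [Ax Sx]]] := ex r rq.
have [|y [[Ay [u ur Sy]] ymin]] := mn (possible r S).
  by exists x; split=> //; exists s.
exists u => //; exists y; split; first by split.
move=> z v vu Az w wv Sz w' _ zy; apply: (ymin z Az) => //.
by exists w => //; apply: fle_trans wv (fle_trans vu ur).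
Qed.

(** If [h x] decides the value at [x] of a name for an injection, the conditions that decide the
    same value [n] are incompatible for distinct [x], so each [n] serves only countably many [x]. *)
Lemma ccc_forces_uncountable p (X : Type) : ccc P -> ~ countable [set: X] ->
  forces p (Not (is_countable (@univ _ X))).
Proof.
move=> cP ucX q qp /(_ q (fle_refl q))[r rq [G [Gmap Ginj]]].
have /choice[h hP] x : exists qn : P * nat,
    fle qn.1 r /\ forces qn.1 ((x, qn.2) ∈ G)%F.
  have [/(_ r (fle_refl r))[s sr [n [_ Gn]]] _] := Gmap x r (fle_refl r) I.
  by exists (s, n).
have compat x y : (h x).2 = (h y).2 -> compatible (h x).1 (h y).1 -> x = y.
  move=> e [s sx sy]; have [hx Gx] := hP x; have [hy Gy] := hP y.
  apply: (Ginj x y (h x).2 s _ I s (fle_refl s) I s (fle_refl s) _ s (fle_refl s)).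
  - exact: fle_trans hx.
  - exact: forces_mono Gx.
  - by rewrite e; apply: forces_mono Gy.
apply: ucX.
have -> : [set: X] = \bigcup_(n in [set: nat]) [set x | (h x).2 = n].
  by apply/seteqP; split=> // x _; exists (h x).2.
apply: bigcup_countable => // n _.
apply: (@inj_countable _ _ (fun x => (h x).1) _
  [set (h x).1 | x in [set x | (h x).2 = n]]).
- move=> x y; rewrite !inE => /= ex ey e; apply: compat; first by rewrite ex.
  by rewrite e; exists (h y).1; apply: fle_refl.
- by move=> x hx; exists x.
apply: cP => _ _ [x /= ex <-] [y /= ey <-] ne /compat.
by rewrite ex ey => /(_ erefl) e; apply: ne; rewrite e.
Qed.

Lemma ccc_forces_omega1 p (W : Type) (lt : W -> W -> Prop) : ccc P ->
  holds (is_omega1 lt) -> forces p (is_omega1 lt).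
Proof.
move=> cP h; have hW := holds_omega1 h; case: h => -[wo _] _.
split; [split|].
- exact: forces_well_ordered wo.
- by apply: ccc_forces_uncountable => //; apply: o1_uncountable hW.
- move=> a; apply: (@forces_countable _ _ _ [set x | lt x a]) => //.
  exact: o1_seg.
Qed.

(** * Levels of a tree in the extension *)

Section Levels.
Variables (W T : Type) (ltW : W -> W -> Prop) (ltT : T -> T -> Prop).
Hypothesis hW : omega1_order ltW.

Definition level_iso (a : W) (t : T) (g : T -> W) :=
  [/\ forall s, ltT s t -> ltW (g s) a,
      forall x, ltW x a -> exists2 s, ltT s t & g s = x,
      {in [set s | ltT s t] &, injective g}
    & forall s s', ltT s t -> ltT s' t -> (ltT s s' <-> ltW (g s) (g s'))].

Lemma holds_on_level a t : holds (on_level _ ltW ltT a t) ->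
  exists g, level_iso a t g.
Proof.
have [w0] := o1_inhabited hW.
move=> [G [[[Gmap Ginj] Gonto] Gmono]].
have /choice[g gP] s : exists x, ltT s t -> ltW x a /\ G (s, x).
  have [st|nst] := pselect (ltT s t); last by exists w0.
  by have [[x [xa Gx]] _] := Gmap s st; exists x.
exists g; split.
- by move=> s /gP[].
- move=> x /Gonto[s [st Gs]]; exists s => //.
  by have [_ u] := Gmap s st; apply: u Gs; apply: (gP s st).2.
- move=> s s'; rewrite !inE => st s't e.
  by apply: (Ginj s s' _ st s't (gP s st).2); rewrite e; apply: (gP s' s't).2.
- move=> s s' st s't.
  by apply: Gmono => //; [apply: (gP s st).2|apply: (gP s' s't).2].
Qed.

Lemma forces_on_level p a t :
  holds (on_level _ ltW ltT a t) -> forces p (on_level _ ltW ltT a t).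
Proof.
move=> [G [[[Gmap Ginj] Gonto] Gmono]]; rewrite /on_level => q qp.
exists q; first exact: fle_refl.
exists (check_name G); split; [split; [split|]|].
- move=> s r rq st; have [[x [xa Gx]] u] := Gmap s st.
  split; last by move=> y z ? _ /forces_check Gy ? _ /forces_check; apply: u.
  move=> r' _; exists r'; first exact: fle_refl.
  by exists x; split=> //; apply/forces_check.
- move=> s s' x ? _ st ? _ s't ? _ /forces_check Gs ? _ /forces_check.
  exact: Ginj Gs.
- move=> x r rq /Gonto[s [st Gs]] r' _; exists r'; first exact: fle_refl.
  by exists s; split=> //; apply/forces_check.
- move=> s s' x x' ? _ st ? _ s't ? _ /forces_check Gs ? _ /forces_check.
  exact: Gmono Gs.
Qed.

(* A name for an isomorphism onto an initial segment of [W] agrees with the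
   ground-model isomorphism, by induction along the predecessors of [t]. *)
Lemma forces_on_level_unique p a b t : holds (on_level _ ltW ltT b t) ->
  forces p (on_level _ ltW ltT a t) -> a = b.
Proof.
move=> /holds_on_level[g [gb gonto _ gmono]].
rewrite /on_level => /(_ p (fle_refl p))[q qp [G [[[Gmap Ginj] Gonto] Gmono]]].
have total s r : ltT s t -> fle r q ->
    exists r' x, [/\ fle r' r, ltW x a & forces r' ((s, x) ∈ G)%F].
  move=> st rq; have [/(_ r (fle_refl r))[r' r'r [x [xa Gx]]] _] := Gmap s r rq st.
  by exists r', x.
have surj x r : ltW x a -> fle r q ->
    exists r' s, [/\ fle r' r, ltT s t & forces r' ((s, x) ∈ G)%F].
  move=> xa rq; have /(_ r (fle_refl r))[r' r'r [s [st Gs]]] := Gonto x r rq xa.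
  by exists r', s.
have func s r x y : ltT s t -> fle r q -> forces r ((s, x) ∈ G)%F ->
    forces r ((s, y) ∈ G)%F -> x = y.
  move=> st rq; have [_ u] := Gmap s r rq st => Gx Gy.
  exact: (u x y r (fle_refl r) Gx r (fle_refl r) Gy).
have mono s s' x x' r : ltT s t -> ltT s' t -> fle r q ->
    forces r ((s, x) ∈ G)%F -> forces r ((s', x') ∈ G)%F ->
    (ltT s s' <-> ltW x x').
  move=> st s't rq Gs Gs'.
  exact: (Gmono s s' x x' r rq st r (fle_refl r) s't r (fle_refl r) Gs
    r (fle_refl r) Gs').
have injG s s' x r : ltT s t -> ltT s' t -> fle r q ->
    forces r ((s, x) ∈ G)%F -> forces r ((s', x) ∈ G)%F -> s = s'.
  move=> st s't rq Gs Gs'.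
  exact: (Ginj s s' x r rq st r (fle_refl r) s't r (fle_refl r) Gs r (fle_refl r) Gs').
have Gg y s : ltT s t -> g s = y -> forces q ((s, g s) ∈ G)%F.
  elim/(o1_ind hW): y s => y ih s st gsy; apply: forces_dense => r rq.
  have [r' [x [r'r xa Gx]]] := total s r st rq.
  exists r' => //; have r'q := fle_trans r'r rq.
  (* A smaller value [x] is already taken by the node that [g] sends to [x]; if [x] is larger, the
     node that [G] sends to [g s] lies below [s], where [G] and [g] agree, so its value is smaller
     than [g s]. *)
  have [xg|<-//|gx] := o1_total hW x (g s); exfalso.
    have [s' s't gs'] := gonto x (o1_trans hW xg (gb s st)).
    have Gs' : forces r' ((s', g s') ∈ G)%F.
      apply: forces_mono r'q _; apply: ih s't erefl.
      by rewrite gs' -gsy.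
    rewrite gs' in Gs'; have e := injG _ _ _ _ st s't r'q Gx Gs'.
    by rewrite e gs' in xg; apply: (o1_irr hW xg).
  have [r2 [s' [r2r s't Gs']]] := surj (g s) r' (o1_trans hW gx xa) r'q.
  have r2q := fle_trans r2r r'q.
  have s's : ltT s' s by apply/(mono _ _ _ _ _ s't st r2q Gs' (forces_mono r2r Gx)).
  have gs's := (gmono _ _ s't st).1 s's.
  have Gs'2 : forces r2 ((s', g s') ∈ G)%F.
    by apply: forces_mono r2q _; apply: ih s't erefl; rewrite -gsy.
  have e := func _ _ _ _ s't r2q Gs' Gs'2.
  by rewrite -e in gs's; apply: o1_irr gs's.
(* Now [G] and [g] agree, so the segments below [a] and [b] that they map onto coincide. *)
have [ab|//|ba] := o1_total hW a b; exfalso.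
  have [s st gs] := gonto a ab.
  have [r [x [rq xa Gx]]] := total s q st (fle_refl q).
  have e := func _ _ _ _ st rq Gx (forces_mono rq (Gg _ s st erefl)).
  by rewrite e gs in xa; apply: o1_irr xa.
have [r [s [rq st Gs]]] := surj b q ba (fle_refl q).
have e := func _ _ _ _ st rq Gs (forces_mono rq (Gg _ s st erefl)).
by have := gb s st; rewrite -e; apply: o1_irr.
Qed.

End Levels.
End Forces.

(** * Preservation of Suslin trees *)

Definition prod_compatible (P : forcing) {T : Type} (c : T -> T -> Prop)
    (x y : P * T) := compatible x.1 y.1 /\ c x.2 y.2.

Section SuslinPreservation.
Variables (P : forcing) (T : Type) (ltT : T -> T -> Prop).
Implicit Types (p q r : P) (S : name P T).

Local Notation cmp := (comparable_by ltT).

Hypothesis ltT_trans : forall y x z, ltT x y -> ltT y z -> ltT x z.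
Hypothesis ltT_pred : forall t x y, ltT x t -> ltT y t -> cmp x y.
Hypothesis pred_countable : forall t, countable [set s | ltT s t].
Hypothesis chain_countable : forall S : set T,
  (forall x y, S x -> S y -> cmp x y) -> countable S.
Hypothesis prodP : ccc_rel (prod_compatible (P := P) cmp).

Lemma cmp_sym x y : cmp x y -> cmp y x.
Proof. by move=> [[h|->]|h]; [right|left; right|left; left]. Qed.

(** Pairing each possible [t] with a condition that forces it into [S] gives an antichain of the
    product. *)
Lemma antichain_possible_countable p S :
  forces p (is_antichain ltT S) -> countable (possible p S).
Proof.
move=> anti.
have /choice[h hP] t : exists q, possible p S t -> fle q p /\ forces q (t ∈ S)%F.
  have [[q qp Sq]|n] := pselect (possible p S t); first by exists q.
  by exists p.
apply: (@inj_countable _ _ (fun t => (h t, t)) _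
  [set (h t, t) | t in possible p S]).
- by move=> x y _ _ [].
- by move=> x px; exists x.
apply: prodP => _ _ [x px <-] [y py <-] ne [[r /= rx ry] cxy].
have [hx Sx] := hP x px; have [hy Sy] := hP y py.
have [nxy nyx] := anti x y r (fle_trans rx hx) (forces_mono rx Sx) r
  (fle_refl r) (forces_mono ry Sy).
case: cxy => [[/(nxy r (fle_refl r))//|e]|/(nyx r (fle_refl r))//].
by apply: ne; rewrite e.
Qed.

Lemma below_countable (K : set T) : countable K ->
  countable [set t | exists2 k, K k & ltT t k \/ t = k].
Proof.
move=> cK.
apply: (@subset_countable _ _ (\bigcup_(k in K) ([set t | ltT t k] `|` [set k]))).
  by move=> t [k Kk h]; exists k.
apply: bigcup_countable => // k _.
by apply: setU_countable; [apply: pred_countable|apply: countable1].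
Qed.

(* Otherwise some [q] forces [S] to be a chain with uncountably many possible
   elements below every [r <= q]. Every node [t] that may be in [S] then has
   an extension [s] which some [r <= q] forces out of the branch, by putting
   in [S] a node [u] incomparable with [s]. Such pairs [(r, s)] with [t]
   outside of any given countable set contradict the ccc of the product. *)
Lemma forces_chain_countable p S :
  forces p (is_chain ltT S) -> forces p (is_countable (fun t => t ∈ S)%F).
Proof.
move=> chain; apply: forces_dense => q qp.
apply: contrapT => nq.
have unc r : fle r q -> ~ countable (possible r S).
  move=> rq cr; apply: nq; exists r => //.
  exact: forces_countable_possible.
have chainq r x y : fle r q -> forces r (x ∈ S)%F -> forces r (y ∈ S)%F -> cmp x y.
  move=> rq Sx Sy; apply/(forces_comparable r).
  exact: (chain x y r (fle_trans rq qp) Sx r (fle_refl r) Sy).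
pose out (x : P * T) u := forces x.1 (u ∈ S)%F /\ ~ cmp u x.2.
pose Y := [set x : P * T | fle x.1 q /\ exists u, out x u].
have [||Z [ZY Zanti Zmax]] := @maximal_antichain _ (prod_compatible (P := P) cmp) Y.
- by move=> x; split; [exists x.1; apply: fle_refl|left; right].
- by move=> x y [[r rx ry] c]; split; [exists r|apply: cmp_sym].
have /choice[u uP] x : exists u, Z x -> out x u.
  have [/ZY[_ [u hu]]|nZ] := pselect (Z x); first by exists u.
  by exists x.2.
pose K := [set x.2 | x in Z] `|` [set u x | x in Z].
have cK : countable K.
  by apply: setU_countable; apply: image_countable; apply: prodP.
have [t [r rq St] tK] : exists2 t, possible q S t &
    ~ exists2 k, K k & ltT t k \/ t = k.
  apply: contrapT => nt; apply: (unc q (fle_refl q)).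
  apply: subset_countable (below_countable cK) => t pt.
  by apply: contrapT => ntK; apply: nt; exists t.
have [r' [s [v [r'r ts [Sv nvs]]]]] : exists r' s v,
    [/\ fle r' r, ltT t s \/ t = s & out (r', s) v].
  (* Otherwise every possible element is below [t], or in the chain of those at or above [t]; both
     sets are countable. *)
  apply: contrapT => nout; apply: (unc r rq).
  have cmpS v s : possible r S v -> ltT t s \/ t = s -> cmp v s.
    move=> [r' r'r Sv] ts; apply: contrapT => nvs.
    by apply: nout; exists r', s, v.
  apply: (@subset_countable _ _
    ([set v | ltT v t] `|` [set v | possible r S v /\ (ltT t v \/ t = v)])).
    move=> v pv; have [[h|e]|h] := cmpS v t pv (or_intror erefl).
    - by left.
    - by right; split=> //; right.
    - by right; split=> //; left.
  apply: setU_countable; first exact: pred_countable.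
  by apply: chain_countable => x y [px _] [_ ty]; apply: cmpS.
have Yr's : Y (r', s) by split; [apply: fle_trans rq|exists v].
(* Neither [s0] nor [u (r0, s0)] is at or above [t], yet both are comparable with [t]. So both lie
   below [t] and are comparable, contrary to the choice of [u]. *)
have [[r0 s0] Z0 [[r1 /= r10 r1r'] cs0s]] := Zmax _ Yr's.
have [Su0 nu0] := uP _ Z0.
have nts0 : ~ (ltT t s0 \/ t = s0).
  by move=> h; apply: tK; exists s0 => //; left; exists (r0, s0).
have ntu0 : ~ (ltT t (u (r0, s0)) \/ t = u (r0, s0)).
  by move=> h; apply: tK; exists (u (r0, s0)) => //; right; exists (r0, s0).
have s0t : ltT s0 t.
  have c : cmp s0 t.
    case: cs0s => [[s0s|e]|ss0].
    - by case: ts => [ts|->]; [apply: ltT_pred ts|left; left].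
    - by exfalso; apply: nts0; rewrite e.
    - exfalso; apply: nts0; left.
      by case: ts => [ts|->//]; apply: ltT_trans ss0.
  by case: c => [[//|e]|h]; exfalso; apply: nts0; [right|left].
have u0t : ltT (u (r0, s0)) t.
  have r1q : fle r1 q by apply: fle_trans r1r' (fle_trans r'r rq).
  have := chainq r1 _ _ r1q (forces_mono r10 Su0)
    (forces_mono (fle_trans r1r' r'r) St).
  by move=> [[//|e]|h]; exfalso; apply: ntu0; [right|left].
by apply: nu0; apply: ltT_pred s0t.
Qed.

End SuslinPreservation.

Theorem suslin_tree_preserved (P : forcing) (W T : Type)
    (ltW : W -> W -> Prop) (ltT : T -> T -> Prop) :
  ccc P -> ccc_rel (prod_compatible (P := P) (comparable_by ltT)) ->
  holds (suslin_tree ltW ltT) -> forced (P := P) (suslin_tree ltW ltT).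
Proof.
move=> cP prodP [[[[[o1 tree] [lev nonempty]] levcount] chain] anti] p.
have hW := holds_omega1 o1.
have [[irr tr] wo] := tree.
have pred_cmp t x y : ltT x t -> ltT y t -> comparable_by ltT x y.
  by move=> xt yt; have [[_ tot] _] := wo t; exact: (tot x y xt yt).
have pred_countable t : countable [set s | ltT s t].
  have [a la] := lev t; have [g [ga _ gi _]] := holds_on_level hW la.
  exact: inj_countable gi ga (o1_seg hW a).
have chain_countable (S : set T) :
    (forall x y, S x -> S y -> comparable_by ltT x y) -> countable S.
  move=> ch; apply: (holds_is_countable (fun t => t ∈ S)%F).1.
  exact: (chain S ch).
split; [split; [split; [split; [split|split]|]|]|].
- exact: ccc_forces_omega1.
- split; [split|].
  + by move=> x q _; apply: irr.
  + move=> x y z q _ xy r _ yz; exact: (tr x y z xy yz).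
  + by move=> t; apply: forces_well_ordered (wo t).
- move=> t q qp; exists q; first exact: fle_refl.
  by have [a at_] := lev t; exists a; apply: forces_on_level.
- move=> a q qp; exists q; first exact: fle_refl.
  by have [t at_] := nonempty a; exists t; apply: forces_on_level.
(* Each node keeps its ground-model level, so no level gains nodes. *)
- move=> a; apply: (@forces_countable _ _ _ _ [set t | holds (on_level _ ltW ltT a t)]).
    move=> t q qp; have [b bt] := lev t.
    by move/(forces_on_level_unique hW bt) => ->.
  exact: (holds_is_countable (on_level _ ltW ltT a)).1 (levcount a).
- move=> S q qp chS; apply: (@forces_chain_countable _ _ ltT) => //.
  by move=> y x z xy yz; apply: (tr x y z xy yz).
- move=> S q qp aS; apply: forces_countable_possible.
  exact: antichain_possible_countable aS.
Qed.

(** * The uniformizing forcing *)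

Section UniformizingForcing.
Variables (W : Type) (lt : W -> W -> Prop).
Hypothesis hW : omega1_order lt.
Variable C : W -> set W.
Hypothesis hC : ladder_system lt C.
Variable f : W -> W -> nat.

(** By cofinality some ladder point [e k] is at or above [d]; the points below [d] have index less
    than [k]. *)
Lemma ladder_below_finite a d : is_limit lt a -> lt d a ->
  finite_set [set x | C a x /\ lt x d].
Proof.
move=> la da; have [_ cof [e emono rng]] := hC la.
have [x Cx dx] := cof d da; rewrite -rng in Cx; case: Cx => k _ ekx.
apply: (@sub_finite_set _ _ (e @` `I_k)); last exact/finite_image/finite_II.
move=> y [] /=; rewrite -rng => -[m _ <-] md; exists m => //=.
have emk : lt (e m) (e k).
  by rewrite ekx; case: dx => [<-//|dx]; apply: (o1_trans hW) dx.
rewrite ltnNge; apply/negP; rewrite leq_eqVlt => /orP[/eqP e1|/emono km].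
  by rewrite e1 in emk; apply: (o1_irr hW emk).
exact: (o1_irr hW (o1_trans hW emk km)).
Qed.

Lemma ladder_inter_finite a b : is_limit lt a -> is_limit lt b -> a <> b ->
  finite_set (C a `&` C b).
Proof.
move=> la lb nab.
have side c d : is_limit lt c -> is_limit lt d -> lt c d ->
    finite_set (C c `&` C d).
  move=> lc ld cd; apply: sub_finite_set (ladder_below_finite ld cd).
  by move=> x [Cc Cd]; split=> //; have [sub _ _] := hC lc; apply: sub.
have [ab|//|ba] := o1_total hW a b; first exact: side.
by rewrite setIC; apply: side.
Qed.

(* [inl (x, n)] is the instruction "phi x = n", and [inr a] the instruction
   "phi = f a on C a"; a condition is a list of instructions, each of which
   yields to the previous ones. *)
Definition instruction : Type := ((W * nat) + W)%type.

Definition obey (i : instruction) (x : W) : option nat :=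
  match i with
  | inl yn => if `[< yn.1 = x >] then Some yn.2 else None
  | inr a => if `[< is_limit lt a /\ C a x >] then Some (f a x) else None
  end.

Fixpoint eval (p : seq instruction) (x : W) : option nat :=
  if p is i :: p' then
    if obey i x is Some n then Some n else eval p' x
  else None.

Lemma eval_cat p q x :
  eval (p ++ q) x = if eval p x is Some n then Some n else eval q x.
Proof. by elim: p => //= i p ->; case: obey. Qed.

Definition extends (p q : seq instruction) :=
  forall x n, eval q x = Some n -> eval p x = Some n.

Definition uniformizing_forcing : forcing.
Proof.
refine (@Forcing (seq instruction) extends [::] _ _ _).
- by move=> p x n.
- by move=> q p r pq qr x n /qr/pq.
- by move=> p x n.
Defined.

Local Notation P := uniformizing_forcing.

Definition agree (p q : seq instruction) :=
  forall x m n, eval p x = Some m -> eval q x = Some n -> m = n.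

(** Since they agree, [p ++ q] describes the union of both functions. *)
Lemma agree_compatible (p q : P) : agree p q -> compatible p q.
Proof.
move=> apq; exists (p ++ q : seq instruction) => x n; rewrite eval_cat => e.
  by rewrite e.
by case ep: (eval p x) => [m|//]; rewrite (apq x m n).
Qed.

(** * Conditions with bounded parameters *)

Definition instr_below (a : W) (i : instruction) : Prop :=
  match i with inl xn => lt xn.1 a | inr b => lt b a end.

Fixpoint below (a : W) (p : seq instruction) : Prop :=
  if p is i :: p' then instr_below a i /\ below a p' else True.

Lemma instr_below_trans a b i : lt a b -> instr_below a i -> instr_below b i.
Proof. by move=> ab; case: i => [[x n]|x] /= xa; apply: (o1_trans hW) ab. Qed.

Lemma below_trans a b p : lt a b -> below a p -> below b p.
Proof.
move=> ab; elim: p => //= i p ih [ia pa].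
by split; [apply: instr_below_trans ia|apply: ih].
Qed.

Lemma below_cat a p q : below a p -> below a q -> below a (p ++ q).
Proof. by elim: p => //= i p ih [ia pa] qa; split=> //; apply: ih. Qed.

Lemma below_ex p : exists a, below a p.
Proof.
elim: p => [|i p [a pa]]; first by have [w] := o1_inhabited hW; exists w.
pose y := match i with inl xn => xn.1 | inr b => b end.
have [|b bP] := @o1_bounded _ _ hW ([set a] `|` [set y]).
  by apply: setU_countable; apply: countable1.
exists b; split; last by apply: below_trans pa; apply: bP; left.
by have := bP y (or_intror erefl); rewrite /y; case: i {y bP} => [[]|].
Qed.

Lemma below_limit d p : is_limit lt d -> below d p ->
  exists2 a, lt a d & below a p.
Proof.
move=> [[w wd] dlim]; elim: p => [|i p ih]; first by exists w.
move=> [id_ /ih[a ad pa]].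
have [b bd ib] : exists2 b, lt b d & instr_below b i.
  by case: i id_ => [[x n]|x] /= /dlim[b xb bd]; exists b.
have [ab|e|ba] := o1_total hW a b.
- by exists b => //; split=> //; apply: below_trans pa.
- by exists a => //; split=> //; rewrite e.
- by exists a => //; split=> //; apply: instr_below_trans ib.
Qed.

Lemma eval_below a p x n : below a p -> eval p x = Some n -> lt x a.
Proof.
elim: p => //= i p ih [ia pa].
case e: (obey i x) => [m|]; last exact: ih.
move=> _; case: i ia e => [[y k]|b] /=.
  by move=> ya; case: asboolP => // <-.
move=> ba; case: asboolP => // -[lb Cb] _.
by have [sub _ _] := hC lb; apply: (o1_trans hW) ba; apply: sub.
Qed.

Lemma conditions_below_countable a : countable [set p | below a p].
Proof.
have /countable_injP[g gi] := o1_seg hW a.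
pose code (i : instruction) : (nat * nat) + nat :=
  match i with inl xn => inl (g xn.1, xn.2) | inr b => inr (g b) end.
apply: (@inj_countable _ _ (map code) _ setT) => //.
move=> p q; rewrite !inE /=.
elim: p q => [|i p ih] [|j q] //= [ia pa] [ja qa] [eij epq].
congr cons; last exact: ih.
case: i j ia ja eij => [[x m]|x] [[y n]|y] //= xa ya.
  by move=> [exy ->]; rewrite (gi x y) // inE.
by move=> [exy]; rewrite (gi x y) // inE.
Qed.

(** Writes a finite function out point by point, to replace the part of a longer ladder below
    [d]. *)
Lemma patch_ex d (S : set W) (v : W -> nat) :
  finite_set S -> (forall x, S x -> lt x d) ->
  exists2 q, below d q &
    forall x, eval q x = if `[< S x >] then Some (v x) else None.
Proof.
move=> fS; have /finite_seqP[s Ss] : finite_set (S : set {classic W}) by [].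
move=> Sd; exists [seq inl (x : W, v x) | x <- s].
  have : forall x, x \in s -> lt x d by move=> x xs; apply: Sd; rewrite Ss.
  elim: s {Ss} => //= x s ih h; split; first by apply: h; rewrite mem_head.
  by apply: ih => y ys; apply: h; rewrite in_cons ys orbT.
move=> x; have -> : `[< S x >] = ((x : {classic W}) \in s).
  by rewrite Ss; apply/asboolP/idP.
elim: s {Ss} => [//|y s ih]; rewrite in_cons /= ih.
case: asboolP => [->|nxy]; first by rewrite eqxx.
by case: eqVneq => //= e; exfalso; apply: nxy.
Qed.

(** For a limit [d], the ladder [C d] is cofinal in [d], so no condition with parameters below [d]
    can replace [inr d]. *)
Fixpoint mentions (d : W) (p : seq instruction) : Prop :=
  if p is i :: p' then i = inr d \/ mentions d p' else False.

(* A ladder [C a] with [d < a] meets [d] in a finite set. *)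
Lemma trace_ex d p : is_limit lt d -> ~ mentions d p ->
  exists2 q, below d q & forall x, lt x d -> eval q x = eval p x.
Proof.
move=> ld; elim: p => [|i p ih] nin; first by exists [::].
have [q' q'd q'P] := ih (fun h => nin (or_intror h)).
have keep : instr_below d i -> exists2 q, below d q &
    forall x, lt x d -> eval q x = eval (i :: p) x.
  by move=> id_; exists (i :: q') => //= x xd; case: obey => //; apply: q'P.
have drop : (forall x, lt x d -> obey i x = None) -> exists2 q, below d q &
    forall x, lt x d -> eval q x = eval (i :: p) x.
  by move=> oN; exists q' => //= x xd; rewrite oN //; apply: q'P.
(* Instructions with parameter below [d] are kept, a ladder of a limit above [d] is patched, and
   anything else is void below [d]. *)
case: i nin keep drop => [[y n]|a] nin keep drop.
  have [yd|nyd] := pselect (lt y d); first exact: keep.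
  by apply: drop => x xd /=; case: asboolP => // e; exfalso; apply: nyd; rewrite e.
have [ad|e|da] := o1_total hW a d; first exact: keep.
  by exfalso; apply: nin; left; rewrite e.
have [la|nla] := pselect (is_limit lt a); last first.
  by apply: drop => x xd /=; case: asboolP => // -[].
have [q qd qP] := patch_ex (f a) (ladder_below_finite la da) (fun x => @proj2 _ _).
exists (q ++ q') => [|x xd]; first exact: below_cat.
rewrite eval_cat qP /= q'P //.
case: asboolP => [[Cx _]|nx]; first by rewrite asboolT.
by case: asboolP => // -[_ Cx]; exfalso; apply: nx.
Qed.

(** An instruction equals [inr (D m)] for at most one [m], and [p] is a finite list. *)
Lemma fresh_instruction (D : nat -> W) p : injective D ->
  exists N, forall n, N <= n -> ~ mentions (D n) p.
Proof.
move=> Di; elim: p => [|i p [N NP]]; first by exists 0 => n _ [].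
have [[m em]|nm] := pselect (exists m, i = inr (D m)).
  exists (maxn N m.+1) => n; rewrite geq_max => /andP[Nn mn] [|]; last exact: NP.
  rewrite em => -[/Di e]; by rewrite e ltnn in mn.
exists N => n Nn [e|]; last exact: NP.
by apply: nm; exists n.
Qed.

(* For a condition [q], let [A q] be a maximal [c]-antichain among the elements
   of [X] whose first component agrees with [q]; it is countable. Let [d] be a
   limit such that [A q] is below [d] for every [q] below [d]. If
   [z] is in [X] and [z.1] does not mention [d], then [z.1] restricted to [d]
   is given by some [q] below [d], so [z] is compatible with an
   element of [A q]. Hence all but countably many elements of [X] mention [d];
   use this for infinitely many [d]. *)
Lemma prod_ccc (T : Type) (c : T -> T -> Prop) :
  (forall x, c x x) -> (forall x y, c x y -> c y x) -> ccc_rel c ->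
  ccc_rel (prod_compatible (P := P) c).
Proof.
move=> crefl csym cccT X anti; apply: contrapT => ncX.
pose c2 (z z' : P * T) := c z.2 z'.2.
have /choice[A AP] q := @maximal_antichain _ c2 [set z | X z /\ agree z.1 q]
  (fun z => crefl z.2) (fun z z' => csym z.2 z'.2).
(* The second components of the members of [A q] are distinct and form a [c]-antichain. *)
have cA q : countable (A q).
  have [_ Aa _] := AP q.
  apply: (@inj_countable _ _ snd _ [set z.2 | z in A q]).
  - move=> z z'; rewrite !inE => Az Az' e; apply: contrapT => /(Aa z z' Az Az').
    by apply; rewrite /c2 e.
  - by move=> z Az; exists z.
  apply: cccT => _ _ [z Az <-] [z' Az' <-] ne; apply: Aa => // e.
  by apply: ne; rewrite e.
pose K a := \bigcup_(q in [set q | below a q]) A q.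
have cK a : countable (K a).
  by apply: bigcup_countable => //; apply: conditions_below_countable.
have /choice[bnd bndP] := below_ex.
have /choice[h hP] a : exists b, lt a b /\ forall z, K a z -> below b z.1.
  have [|b bP] := @o1_bounded _ _ hW ([set a] `|` [set bnd z.1 | z in K a]).
    by apply: setU_countable; [apply: countable1|apply: image_countable].
  exists b; split; first by apply: bP; left.
  move=> z Kz; apply: below_trans (bndP z.1); apply: bP.
  by right; exists z.
have /choice[dl dlP] a0 : exists d, [/\ lt a0 d, is_limit lt d
    & forall q z, below d q -> A q z -> below d z.1].
  have [d [a0d ld dP]] := o1_closure_limit hW a0 (fun a => (hP a).1).
  exists d; split=> // q z /(below_limit ld)[a /dP[b [ab bd hbd]] qa] Az.
  apply: below_trans hbd _; apply: (hP b).2; exists q => //.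
  exact: below_trans qa.
have [w0] := o1_inhabited hW.
pose D n := iter n dl (dl w0).
have DP n : is_limit lt (D n) /\ forall q z, below (D n) q -> A q z -> below (D n) z.1.
  by case: n => [|n]; rewrite /D /=; [have [_ ? ?] := dlP w0|have [_ ? ?] := dlP (D n)].
have Dmono m n : m < n -> lt (D m) (D n).
  elim: n => // n ih; rewrite ltnS leq_eqVlt.
  have [Dn _ _] := dlP (D n).
  by move=> /orP[/eqP->//|/ih mn]; apply: (o1_trans hW) Dn.
have Di : injective D.
  move=> m n e; have [mn|nm|//] := ltngtP m n; exfalso.
    by have := Dmono m n mn; rewrite e; exact: (o1_irr hW (x := D n)).
  by have := Dmono n m nm; rewrite e; exact: (o1_irr hW (x := D n)).
have [z Xz nz] : exists2 z, X z & forall n, ~ K (D n) z.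
  apply: contrapT => nz; apply: ncX.
  apply: (@subset_countable _ _ (\bigcup_(n in [set: nat]) K (D n))).
    move=> z Xz; apply: contrapT => nKz; apply: nz; exists z => // n Kz.
    by apply: nKz; exists n.
  exact: bigcup_countable.
have [N /(_ N (leqnn N)) nin] := fresh_instruction z.1 Di.
have [lD closed] := DP N.
have [q qD qP] := trace_ex lD nin.
have [Asub _ Amax] := AP q.
have [|z' Az' cz'z] := Amax z.
  split=> // x m n zm qn.
  by have := qP x (eval_below qD qn); rewrite zm qn => -[].
have [Xz' agr] := Asub z' Az'.
(* [z'] lies in [K (D N)] and [z] does not, so they differ. Below [D N], which contains the domain
   of [z'.1], [q] and [z.1] coincide, so [z'.1] agrees with [z.1]. *)
apply: (anti z' z Xz' Xz).
  by move=> e; apply: (nz N); exists q => //; rewrite -e.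
split=> //; apply: agree_compatible => x m n z'm zn.
apply: (agr x) => //; rewrite -zn; apply: qP.
exact: eval_below (closed q z' qD Az') z'm.
Qed.

Lemma uniformizing_ccc : ccc P.
Proof.
have cccU : ccc_rel (fun _ _ : unit => True).
  by move=> A _; apply: countableP.
move=> A anti.
apply: (@inj_countable _ _ (fun p => (p, tt)) _ [set (p, tt) | p in A]).
- by move=> p q _ _ [].
- by move=> p Ap; exists p.
apply: (prod_ccc _ _ cccU) => // _ _ [p Ap <-] [q Aq <-] ne [cpq _].
by apply: (anti p q) => // e; apply: ne; rewrite e.
Qed.

(** A condition is coded by a bound and its index among the countably many conditions below that
    bound; such pairs embed in [W]. *)
Lemma uniformizing_card : ([set: P] #= [set: W])%card.
Proof.
apply/card_eqPle; split; last first.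
  by apply: (@card_leT_inj _ P (fun a => [:: inr a])) => a b [].
have /choice[bnd bndP] := below_ex.
have /choice[code codeP] a : exists g : seq instruction -> nat,
    {in [set p | below a p] &, injective g}.
  exact/countable_injP/conditions_below_countable.
have [G GP] := o1_prod_nat_inj hW.
apply: (@card_leT_inj P _ (fun p => G (bnd p) (code (bnd p) p))).
move=> p q /GP[e]; rewrite e; apply: codeP; rewrite inE /=; last exact: bndP.
by rewrite -e; apply: bndP.
Qed.

(** * The generic uniformization *)

Lemma uniformizing_exceptions_finite a p : is_limit lt a ->
  finite_set [set x | C a x /\ eval (p ++ [:: inr a]) x <> Some (f a x)].
Proof.
move=> la; elim: p => [|i p ih].
  apply: (@sub_finite_set _ _ set0); last exact: finite_set0.
  by move=> x [Cx] /=; case: asboolP => // -[].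
(* Prepending an instruction spoils finitely many points: at most one for [inl], none for [inr a],
   and only points of the intersection of the two ladders for another [inr b]. *)
apply: (@sub_finite_set _ _
    ([set x | C a x /\ exists2 n, obey i x = Some n & n <> f a x] `|`
    [set x | C a x /\ eval (p ++ [:: inr a]) x <> Some (f a x)])).
  move=> x [Cx] /=; case e: (obey i x) => [n|] ne; last by right.
  by left; split=> //; exists n => // en; apply: ne; rewrite en.
rewrite finite_setU; split=> //; case: i => [[y n]|b].
  apply: sub_finite_set (finite_set1 y) => x [_ [m]] /=.
  by case: asboolP.
have [e|nab] := pselect (b = a).
  apply: (@sub_finite_set _ _ set0); last exact: finite_set0.
  move=> x [_ [m]] /=; case: asboolP => // _ [<-]; by rewrite e.
have [lb|nlb] := pselect (is_limit lt b); last first.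
  apply: (@sub_finite_set _ _ set0); last exact: finite_set0.
  by move=> x [_ [m]] /=; case: asboolP => // -[].
apply: sub_finite_set (ladder_inter_finite lb la nab) => x [Ca [m]] /=.
by case: asboolP => // -[].
Qed.

(** A name for the union of the partial functions described by the generic conditions. *)
Definition generic_function : name P (W * nat) :=
  [set xnp | eval xnp.2 xnp.1.1 = Some xnp.1.2].

Lemma forces_generic (p : P) x n :
  eval p x = Some n -> forces p ((x, n) ∈ generic_function)%F.
Proof. by move=> px q qp; exists q; [apply: fle_refl|exists p]. Qed.

Lemma forces_generic_eval (p : P) x n :
  forces p ((x, n) ∈ generic_function)%F ->
  exists2 q : P, fle q p & eval q x = Some n.
Proof.
move=> /(_ p (fle_refl p))[q qp [s sx qs]].
by exists q => //; apply: qs.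
Qed.

Lemma uniformizing_forced : forced (P := P) (has_uniformization lt C f).
Proof.
move=> p p' _; exists p'; first exact: fle_refl.
exists generic_function; split.
  move=> x q _ _; split.
    move=> r _; case e: (eval r x) => [n|].
      exists r; first exact: fle_refl.
      by exists n; split=> //; apply: forces_generic.
    exists (r ++ [:: inl (x, 0)] : seq instruction).
      by move=> y n; rewrite eval_cat => ->.
    exists 0; split=> //; apply: forces_generic.
    by rewrite eval_cat e /= asboolT.
  move=> y z r _ ry s sr sz.
  have [u us uz] := forces_generic_eval sz.
  have uy := @forces_mono P ((x, y) ∈ generic_function)%F _ _ (fle_trans us sr) ry.
  have [v vu vy] := forces_generic_eval uy.
  by have := vu _ _ uz; rewrite vy => -[].
move=> a q _ la.
apply: (@forces_dense P (is_finite
  (fun x => Atom (C a x) && ~~ ((x, f a x) ∈ generic_function))%F)) => r _.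
(* Appended last, [inr a] yields to [r], so the result extends [r] and follows [f a] on all but
   finitely many points of [C a]. *)
exists (r ++ [:: inr a] : seq instruction).
  by move=> y n; rewrite eval_cat => ->.
apply: (@forces_finite _ _ _ _ _ _ (uniformizing_exceptions_finite r la)).
move=> x s sr [Cx ns]; split=> // e.
by apply: (ns s (fle_refl s)); apply: forces_generic; apply: sr.
Qed.

End UniformizingForcing.

Theorem mainTheorem6 (W : Type) (lt : W -> W -> Prop)
    (hW : holds (is_omega1 lt))
    (C : W -> set W) (hC : ladder_system lt C)
    (f : W -> W -> nat) :
  exists P : forcing,
    [/\ ccc P,
        ([set: P] #= [set: W])%card,
        forced (P := P) (has_uniformization lt C f)
      & forall (T : Type) (ltT : T -> T -> Prop),
          holds (suslin_tree lt ltT) ->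
          forced (P := P) (suslin_tree lt ltT)].
Proof.
have o1 := holds_omega1 hW.
exists (uniformizing_forcing lt C f); split.
- exact: uniformizing_ccc.
- exact: uniformizing_card.
- exact: uniformizing_forced.
move=> T ltT sT; apply: suslin_tree_preserved (sT); first exact: uniformizing_ccc.
apply: prod_ccc => //.
- by move=> x; left; right.
- exact: cmp_sym.
(* Pairwise incomparable nodes form an antichain of the tree, so the tree is ccc under
   comparability. *)
case: sT => [[[[[_ tree] _] _] _] anti] A Aanti.
apply: (holds_is_countable (fun t => t ∈ A)%F).1; apply: anti => x y Ax Ay.
have [[irr _] _] := tree.
have [<-|nxy] := pselect (x = y); first by split; apply: irr.
by split=> h; apply: (Aanti x y Ax Ay nxy); [left; left|right].
Qed.
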